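(* Let $\mathbf{i}$ be the imaginary unit and let $S_{12}$ be the $12\times 12$ matrix with entries $[S_{12}]_{j,l}=e^{2\pi\mathbf{i}\,E_{j,l}/36}$, where $$E=\left[\begin{array}{cccccccccccc} 0 & 0 & 0 & 0 & 0 & 0 & 0 & 0 & 0 & 0 & 0 & 0 \\ 0 & 24 & 12 & 0 & 24 & 12 & 0 & 24 & 12 & 0 & 24 & 12 \\ 0 & 12 & 24 & 9 & 21 & 33 & 0 & 12 & 24 & 9 & 21 & 33 \\ 0 & 24 & 12 & 18 & 6 & 30 & 0 & 24 & 12 & 18 & 6 & 30 \\ 0 & 12 & 24 & 27 & 3 & 15 & 0 & 12 & 24 & 27 & 3 & 15 \\ 0 & 0 & 0 & 18 & 18 & 18 & 9 & 9 & 9 & 27 & 27 & 27 \\ 0 & 4 & 8 & 0 & 4 & 8 & 18 & 22 & 26 & 18 & 22 & 26 \\ 0 & 16 & 32 & 0 & 16 & 32 & 18 & 34 & 14 & 18 & 34 & 14 \\ 0 & 28 & 20 & 0 & 28 & 20 & 18 & 10 & 2 & 18 & 10 & 2 \\ 0 & 12 & 24 & 18 & 30 & 6 & 18 & 30 & 6 & 0 & 12 & 24 \\ 0 & 24 & 12 & 18 & 6 & 30 & 18 & 6 & 30 & 0 & 24 & 12 \\ 0 & 0 & 0 & 18 & 18 & 18 & 27 & 27 & 27 & 9 & 9 & 9 \end{array}\right].$$ For real parameters $a,b,c,d,e$ (here $e$ denotes a real parameter in the matrix $R$ below) let $$R(a,b,c,d,e)=\left[\begin{array}{cccccccccccc}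 0&0&0&0&0&0&0&0&0&0&0&0 \\ 0&0&0& e & e & e &0&0&0& e & e & e \\ 0&0&0& d & d & d &0&0&0& d & d & d \\ 0&0&0& e & e & e &0&0&0& e & e & e \\ 0&0&0& d & d & d &0&0&0& d & d & d \\ 0&0&0&0&0&0& c & c & c & c & c & c \\ 0& a & b &0& a & b &0& a & b &0& a & b \\ 0& a & b &0& a & b &0& a & b &0& a & b \\ 0& a & b &0& a & b &0& a & b &0& a & b \\ 0&0&0&0&0&0&0&0&0&0&0&0 \\ 0&0&0&0&0&0&0&0&0&0&0&0 \\ 0&0&0&0&0&0& c & c & c & c & c & c \end{array}\right].$$ Let $S_{12}^{(5)}(a,b,c,d,e)$ be the $12\times 12$ matrix with entries $[S_{12}]_{j,l}\cdot\exp(\mathbf{i}R(a,b,c,d,e)_{j,l})$. Then $S_{12}^{(5)}(a,b,c,d,e)$ is a complex Hadamard matrix for all real $a,b,c,d,e$, and there is a neighbourhood $U$ of $S_{12}$ in $\mathbb{C}^{12\times 12}$ such that every member of this family lying in $U$ is not Dita-type.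
   Context: A complex Hadamard matrix of order $r$ is an $r\times r$ complex matrix all of whose entries have absolute value $1$ and whose rows are pairwise orthogonal with respect to the standard Hermitian inner product. Two complex Hadamard matrices $K_1,K_2$ are equivalent if $K_1=D_1P_1K_2P_2D_2$ for some unitary diagonal matrices $D_1,D_2$ and permutation matrices $P_1,P_2$. A complex Hadamard matrix of order $N$ is called Dita-type if, for some integers $k,n\ge 2$ with $kn=N$, it is equivalent to a block matrix $$K=\begin{bmatrix} m_{11}N_1&\cdots&m_{1k}N_k\\ \vdots&&\vdots\\ m_{k1}N_1&\cdots&m_{kk}N_k\end{bmatrix},$$ where $M=(m_{ij})$ is some $k\times k$ complex Hadamard matrix and $N_1,\dots,N_k$ are some $n\times n$ complex Hadamard matrices (possibly different from each other). *)

(* Defs.v *)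
From mathcomp Require Import all_boot all_order all_algebra.
From mathcomp Require Import complex.
From mathcomp Require Import all_classical all_reals all_analysis.

Set Implicit Arguments.
Unset Strict Implicit.
Unset Printing Implicit Defensive.

Import Order.TTheory GRing.Theory Num.Theory.
Import numFieldNormedType.Exports.

Local Open Scope ring_scope.

Lemma sum_nat_const_ord (k n : nat) : (\sum_(i < k) n = k * n)%N.
Proof. by rewrite sum_nat_const card_ord. Qed.

Section Hadamard.
Variable C : numClosedFieldType.

Definition hadamard (r : nat) (H : 'M[C]_r) : Prop :=
  (forall i j, `|H i j| = 1) /\
  (forall i i', i != i' -> \sum_j H i j * (H i' j)^* = 0).

Definition hadamard_equiv (r : nat) (K1 K2 : 'M[C]_r) : Prop :=
  exists D1 D2 P1 P2 : 'M[C]_r,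
    [/\ is_diag_mx D1 /\ D1 \is unitarymx,
        is_diag_mx D2 /\ D2 \is unitarymx,
        is_perm_mx P1,
        is_perm_mx P2 &
        K1 = D1 *m P1 *m K2 *m P2 *m D2].

(* [\mxblock] has dimension [\sum_(i < k) n], recast here to [k * n]. *)
Definition dita_block (k n : nat) (M : 'M[C]_k) (B : 'I_k -> 'M[C]_n) :
    'M[C]_(k * n) :=
  castmx (sum_nat_const_ord k n, sum_nat_const_ord k n)
    (\mxblock_(i < k, j < k) (M i j *: B j)).

(* Meant for Hadamard [K]; any [K] satisfying this is in fact Hadamard. *)
Definition dita_type (N : nat) (K : 'M[C]_N) : Prop :=
  exists (k n : nat) (knN : (k * n = N)%N) (M : 'M[C]_k) (B : 'I_k -> 'M[C]_n),
    [/\ (2 <= k)%N, (2 <= n)%N, hadamard M, (forall j, hadamard (B j)) &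
        hadamard_equiv K (castmx (knN, knN) (dita_block M B))].

End Hadamard.

Section S12.
Variable R : realType.

(* e^{it}; MathComp-Analysis has no complex exponential. *)
Definition expi (t : R) : R[i] := Complex (cos t) (sin t).

Definition matrix12 (T : nmodType) (s : seq (seq T)) : 'M[T]_12 :=
  \matrix_(j, l) nth 0 (nth [::] s j) l.

Definition S12_exponents : 'M[nat]_12 := matrix12 [::
  [:: 0; 0; 0; 0; 0; 0; 0; 0; 0; 0; 0; 0];
  [:: 0; 24; 12; 0; 24; 12; 0; 24; 12; 0; 24; 12];
  [:: 0; 12; 24; 9; 21; 33; 0; 12; 24; 9; 21; 33];
  [:: 0; 24; 12; 18; 6; 30; 0; 24; 12; 18; 6; 30];
  [:: 0; 12; 24; 27; 3; 15; 0; 12; 24; 27; 3; 15];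
  [:: 0; 0; 0; 18; 18; 18; 9; 9; 9; 27; 27; 27];
  [:: 0; 4; 8; 0; 4; 8; 18; 22; 26; 18; 22; 26];
  [:: 0; 16; 32; 0; 16; 32; 18; 34; 14; 18; 34; 14];
  [:: 0; 28; 20; 0; 28; 20; 18; 10; 2; 18; 10; 2];
  [:: 0; 12; 24; 18; 30; 6; 18; 30; 6; 0; 12; 24];
  [:: 0; 24; 12; 18; 6; 30; 18; 6; 30; 0; 24; 12];
  [:: 0; 0; 0; 18; 18; 18; 27; 27; 27; 9; 9; 9]]%N.

Definition S12 : 'M[R[i]]_12 :=
  \matrix_(j, l) expi (2 * pi * (S12_exponents j l)%:R / 36).

Definition S12_phases (a b c d e : R) : 'M[R]_12 := matrix12 [::
  [:: 0; 0; 0; 0; 0; 0; 0; 0; 0; 0; 0; 0];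
  [:: 0; 0; 0; e; e; e; 0; 0; 0; e; e; e];
  [:: 0; 0; 0; d; d; d; 0; 0; 0; d; d; d];
  [:: 0; 0; 0; e; e; e; 0; 0; 0; e; e; e];
  [:: 0; 0; 0; d; d; d; 0; 0; 0; d; d; d];
  [:: 0; 0; 0; 0; 0; 0; c; c; c; c; c; c];
  [:: 0; a; b; 0; a; b; 0; a; b; 0; a; b];
  [:: 0; a; b; 0; a; b; 0; a; b; 0; a; b];
  [:: 0; a; b; 0; a; b; 0; a; b; 0; a; b];
  [:: 0; 0; 0; 0; 0; 0; 0; 0; 0; 0; 0; 0];
  [:: 0; 0; 0; 0; 0; 0; 0; 0; 0; 0; 0; 0];
  [:: 0; 0; 0; 0; 0; 0; c; c; c; c; c; c]].

Definition S12_family (a b c d e : R) : 'M[R[i]]_12 :=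
  \matrix_(j, l) (S12 j l * expi (S12_phases a b c d e j l)).

End S12.

(* Main.v *)
Require Import Defs.
From mathcomp Require Import all_boot all_order all_algebra.
From mathcomp Require Import complex.
From mathcomp Require Import all_classical all_reals all_analysis.
From mathcomp Require Import fingroup perm ring lra.

Import Order.TTheory GRing.Theory Num.Theory.
Import numFieldNormedType.Exports.

Local Open Scope ring_scope.

(** A Dita-type matrix of order [N = k n] contains, through any given entry, a
    [k] x [n] submatrix of rank one.  In the family every entry of the first row
    and column is 1, so such a submatrix through the corner consists of ones.
    Whether an entry differs from 1 is an open condition, hence near [S12] these
    ones can only sit where the exponent vanishes, and [S12] has no rectangle of
    12 zero exponents with both sides at least 2.

    For orthogonality, the terms of an inner product of two rows are grouped by
    their dependence on the parameters; each group is a sum of 36th roots of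
    unity that vanishes because of the relation [w ^ 12 = w ^ 6 - 1]. *)

(** * Finite sums, tables and neighbourhoods of matrices *)

Lemma sum_fibres_eq0 (V : nmodType) (I : finType) (K : eqType)
    (key : I -> K) (F : I -> V) :
  (forall i, \sum_(j | key j == key i) F j = 0) -> \sum_i F i = 0.
Proof.
(* [K] may be infinite, so the partition is indexed by the fibres themselves, as subsets of [I]. *)
move=> F0; pose cls i : {set I} := finset (fun j => key j == key i).
have clsE i j : (cls j == cls i) = (key j == key i).
  apply/eqP/eqP => [/setP/(_ j)|kji]; first by rewrite !inE eqxx => /esym/eqP.
  by apply/setP => l; rewrite !inE kji.
rewrite (partition_big cls (mem (cls @: [set: I]%SET))) /=; last first.
  by move=> i _; rewrite imset_f// inE.
apply: big1 => _ /imsetP[i _ ->].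
by rewrite -[RHS](F0 i); apply: eq_bigl => j; rewrite clsE.
Qed.

(** Big operators are locked, whereas a [foldr] over a concrete list can be evaluated by
    [vm_compute]. *)
Lemma sum_ord_foldr (V : nmodType) (n : nat) (P : pred nat) (F : nat -> V) :
  \sum_(j < n | P j) F j =
  foldr (fun j s => if P j then F j + s else s) 0 (iota 0 n).
Proof. by rewrite -(big_mkord P F) /index_iota subn0 unlock. Qed.

Lemma all_iota_ord (n : nat) (P : pred nat) :
  all P (iota 0 n) -> forall i : 'I_n, P i.
Proof. by move=> /allP allP i; rewrite allP // mem_iota ltn_ord. Qed.

Lemma nth_nth_map (S T : Type) (f : S -> T) (x0 : S) (s : seq (seq S)) i j :
  nth (f x0) (nth [::] (map (map f) s) i) j = f (nth x0 (nth [::] s i) j).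
Proof.
have nth_map_dflt (U V : Type) (g : U -> V) u (r : seq U) l :
    nth (g u) (map g r) l = g (nth u r l).
  have [lr|rl] := ltnP l (size r); first exact: nth_map.
  by rewrite !nth_default ?size_map.
by rewrite -[[::]]/(map f [::]) !nth_map_dflt.
Qed.

Lemma near_mx_entrywise (T : topologicalType) (m n : nat) (M : 'M[T]_(m, n))
    (P : 'I_m -> 'I_n -> set T) :
  (forall i j, nbhs (M i j) (P i j)) ->
  nbhs M [set N : 'M[T]_(m, n) | forall i j, P i j (N i j)]%classic.
Proof. by move=> MP; exists P. Qed.

(** * Rank-one submatrices of Dita-type matrices *)

Section DitaType.
Variable C : numClosedFieldType.

Lemma hadamard_equiv_entries (r : nat) (K1 K2 : 'M[C]_r) :
  hadamard_equiv K1 K2 ->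
  exists (d1 d2 : 'I_r -> C) (s t : {perm 'I_r}),
    forall x y, K1 x y = d1 x * K2 (s x) (t y) * d2 y.
Proof.
move=> [D1 [D2 [P1 [P2 [[/diag_mxP[d1 ->] _] [/diag_mxP[d2 ->] _]]]]]].
move=> /is_perm_mxP[s ->] /is_perm_mxP[t ->] ->.
(* Right multiplication by [perm_mx t] moves columns by the inverse of [t]. *)
exists (d1 0), (d2 0), s, (t^-1)%g => x y.
by rewrite -{1}[t]invgK -[_ *m perm_mx s *m K2]mulmxA -row_permE -col_permE
  mul_mx_diag mul_diag_mx !mxE.
Qed.

Lemma dita_block_entries (N k n : nat) (knN : (k * n = N)%N)
    (M : 'M[C]_k) (B : 'I_k -> 'M[C]_n) :
  exists2 coord : 'I_N -> 'I_k * 'I_n, bijective coord &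
    forall x y, castmx (knN, knN) (dita_block M B) x y =
      M (coord x).1 (coord y).1 * B (coord y).1 (coord x).2 (coord y).2.
Proof.
subst N; pose c (x : 'I_(k * n)) := cast_ord (esym (sum_nat_const_ord k n)) x.
pose coord x : 'I_k * 'I_n :=
  (tagnat.sig1 (c x), @tagnat.sig2 k (fun=> n) (c x)).
exists coord => [|x y]; last by rewrite castmx_id castmxE !mxE.
apply: inj_card_bij => [x y|]; last by rewrite card_prod !card_ord.
move=> -[e1 e2]; apply: (@cast_ord_inj _ _ (esym (sum_nat_const_ord k n))).
rewrite -/(c x) -/(c y).
rewrite -(@tagnat.sig2K k (fun=> n) (c x)) -(@tagnat.sig2K k (fun=> n) (c y)).
by rewrite e1 e2.
Qed.

(* [X] is the set of rows with the same inner index as [x0], and [Y] the set of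
   columns in the same block column as [y0]; on [X] x [Y] the matrix has rank
   one. *)
Lemma dita_type_rank_one_submatrix (N : nat) (K : 'M[C]_N) (x0 y0 : 'I_N) :
  dita_type K ->
  exists X Y : {set 'I_N},
    [/\ (1 < #|X|)%N, (1 < #|Y|)%N, (#|X| * #|Y|)%N = N &
        forall x y, x \in X -> y \in Y -> K x y * K x0 y0 = K x y0 * K x0 y].
Proof.
move=> [k [n [knN [M [B [k2 n2 _ _ /hadamard_equiv_entries]]]]]].
move=> [d1 [d2 [s [t KE]]]].
have [coord coordB BE] := dita_block_entries N k n knN M B.
pose X := (coord \o s) @^-1: (finset.setX [set: 'I_k] [set (coord (s x0)).2])%SET.
pose Y := (coord \o t) @^-1: (finset.setX [set (coord (t y0)).1] [set: 'I_n])%SET.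
have cardX : #|X| = k.
  rewrite on_card_preimset; last first.
    by apply: onW_bij; apply: bij_comp => //; exists (s^-1)%g => ?; rewrite ?permK ?permKV.
  by rewrite cardsX cardsT cards1 card_ord muln1.
have cardY : #|Y| = n.
  rewrite on_card_preimset; last first.
    by apply: onW_bij; apply: bij_comp => //; exists (t^-1)%g => ?; rewrite ?permK ?permKV.
  by rewrite cardsX cardsT cards1 card_ord mul1n.
exists X, Y; rewrite cardX cardY; split => // x y.
rewrite !inE /= andbT => /eqP xX /eqP yY.
(* With the block column and the inner row index fixed, each entry is a factor depending on its row
   times a factor depending on its column. *)
by rewrite !KE !BE xX yY; ring.
Qed.

End DitaType.

(** * Powers of a primitive 36th root of unity *)

Section Expi.
Variable R : realType.
Implicit Types t u : R.

Lemma expi0 : expi (0 : R) = 1.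
Proof. by rewrite /expi cos0 sin0. Qed.

Lemma expiD t u : expi (t + u) = expi t * expi u.
Proof. by rewrite /expi cosD sinD; apply/eqP; rewrite eq_complex /= eqxx addrC eqxx. Qed.

Lemma expiMn t n : expi (t *+ n) = expi t ^+ n.
Proof. by elim: n => [|n IHn]; rewrite ?expi0 // mulrS exprS expiD IHn. Qed.

Lemma conj_expi t : (expi t)^* = expi (- t).
Proof. by rewrite /expi cosN sinN. Qed.

Lemma norm_expi t : `|expi t| = 1.
Proof. by rewrite normc_def /= cos2Dsin2 sqrtr1. Qed.

(** The real part is less than 1, since [cos t] is 1 minus twice the square of [sin (t / 2)], and
    [t / 2] lies strictly between 0 and [pi]. *)
Lemma expi_neq1 t : 0 < t < 2 * pi -> expi t != 1.
Proof.
move=> /andP[t0 t2pi]; rewrite eq_complex negb_and; apply/orP; left => /=.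
have -> : t = (t / 2) *+ 2 by rewrite -mulr_natr divfK.
have s0 : 0 < sin (t / 2) by apply: sin_gt0_pi; apply/andP; split; lra.
rewrite cos_mulr2n; have := cos2Dsin2 (t / 2).
have := exprn_gt0 2 s0; lra.
Qed.

Definition omega : R[i] := expi (2 * pi / 36).

Lemma expi_omega n : expi (2 * pi * n%:R / 36) = omega ^+ n.
Proof. by rewrite /omega -expiMn; congr expi; rewrite -[RHS]mulr_natr [LHS]mulrAC. Qed.

Lemma omega_neq1 n : (0 < n < 36)%N -> omega ^+ n != 1.
Proof.
move=> /andP[n0 n36]; rewrite -expi_omega expi_neq1 //.
have pi2 : 0 < 2 * pi :> R by rewrite mulr_gt0 // pi_gt0.
apply/andP; split; first by rewrite divr_gt0 // mulr_gt0 // ltr0n.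
by rewrite ltr_pdivrMr // ltr_pM2l // ltr_nat.
Qed.

Lemma omega36 : omega ^+ 36 = 1.
Proof.
rewrite -expi_omega mulfK ?pnatr_eq0 // mulrC mulr_natr /expi cos2pi.
by rewrite sin_mulr2n sinpi mulr0 mul0rn.
Qed.

Lemma conj_omegaX m : (m <= 36)%N -> (omega ^+ m)^* = omega ^+ (36 - m).
Proof.
move=> m36; have w1 : (omega ^+ m)^* * omega ^+ m = 1.
  by rewrite -expi_omega conj_expi -expiD addNr expi0.
by rewrite -[RHS]mul1r -w1 -mulrA -exprD subnKC // omega36 mulr1.
Qed.

(** For [z = omega ^+ 6] one has [z ^+ 6 - 1 = (z ^+ 3 - 1) * (z + 1) * (z ^+ 2 - z + 1)], and the
    first two factors do not vanish. *)
Lemma omega12 : omega ^+ 12 = omega ^+ 6 - 1.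
Proof.
have w12 : omega ^+ 12 - 1 != 0 by rewrite subr_eq0 omega_neq1.
have w18 : omega ^+ 18 - 1 != 0 by rewrite subr_eq0 omega_neq1.
have : (omega ^+ 18 - 1) * (omega ^+ 6 + 1) * (omega ^+ 12 - omega ^+ 6 + 1) = 0.
  have -> : (omega ^+ 18 - 1) * (omega ^+ 6 + 1) * (omega ^+ 12 - omega ^+ 6 + 1)
    = omega ^+ 36 - 1 by ring.
  by rewrite omega36 subrr.
move=> /eqP; rewrite 2!mulf_eq0 (negPf w18) => /orP[/eqP w6|/eqP wE].
  move: w12; have -> : omega ^+ 12 - 1 = (omega ^+ 6 + 1) * (omega ^+ 6 - 1) by ring.
  by rewrite w6 mul0r eqxx.
by apply/eqP; rewrite -subr_eq0 opprB addrA addrAC wE.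
Qed.

(* Coordinates of [omega ^+ (6 * q)] in the basis 1, [omega ^+ 6]. *)
Definition sixth_root_coords (q : nat) : int * int :=
  nth (0, 0) [:: (1, 0); (0, 1); (-1, 1); (-1, 0); (0, -1); (1, -1)] (q %% 6).

(** Powers of [omega] whose exponents agree modulo 6 sum to 0 as soon as their integer coordinates
    do. *)
Lemma omega_coords n :
  omega ^+ n = omega ^+ (n %% 6) *
    ((sixth_root_coords (n %/ 6)).1%:~R +
     (sixth_root_coords (n %/ 6)).2%:~R * omega ^+ 6).
Proof.
rewrite {1}(divn_eq n 6) exprD mulrC mulnC exprM; congr (_ * _).
move: (n %/ 6)%N => q; rewrite /sixth_root_coords.
set z := omega ^+ 6.
have z2 : z ^+ 2 = z - 1 by rewrite -exprM omega12.
have z6 : z ^+ 6 = 1 by rewrite -exprM omega36.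
rewrite {1}(divn_eq q 6) exprD mulnC exprM z6 expr1n mul1r.
have z3 : z ^+ 3 = -1 by rewrite exprS z2 mulrBr -expr2 z2; ring.
have : (q %% 6 < 6)%N by rewrite ltn_mod.
case: (q %% 6)%N => [|[|[|[|[|[|//]]]]]] _ /=; rewrite ?z2 ?z3; try by ring.
  by rewrite exprS z3; ring.
by rewrite -[5%N]/(3 + 2)%N exprD z3 z2; ring.
Qed.

End Expi.

(** * Entries of the family as computable tables *)

(* The table inside [S12_exponents]: matrices do not reduce in the kernel, lists do. *)
Definition exponent_table : seq (seq nat) :=
  ltac:(let m := eval unfold S12_exponents in S12_exponents in
        lazymatch m with matrix12 ?s => exact s end).

Definition exponent (i j : nat) : nat := nth 0%N (nth [::] exponent_table i) j.

Lemma S12_exponentsE i j : S12_exponents i j = exponent i j.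
Proof. by rewrite mxE. Qed.

Lemma exponent_lt36 (i j : 'I_12) : (exponent i j < 36)%N.
Proof.
have : all (fun i => all (fun j => exponent i j < 36)%N (iota 0 12)) (iota 0 12).
  by vm_compute.
by move=> check; exact: (all_iota_ord _ _ (all_iota_ord _ _ check i) j).
Qed.

Lemma S12E (R : realType) i j : S12 R i j = omega R ^+ exponent i j.
Proof. by rewrite mxE S12_exponentsE expi_omega. Qed.

(* Entry [m] > 0 stands for the [m]-th of the parameters a, b, c, d, e. *)
Definition phase_table : seq (seq nat) :=
  [:: [:: 0; 0; 0; 0; 0; 0; 0; 0; 0; 0; 0; 0];
      [:: 0; 0; 0; 5; 5; 5; 0; 0; 0; 5; 5; 5];
      [:: 0; 0; 0; 4; 4; 4; 0; 0; 0; 4; 4; 4];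
      [:: 0; 0; 0; 5; 5; 5; 0; 0; 0; 5; 5; 5];
      [:: 0; 0; 0; 4; 4; 4; 0; 0; 0; 4; 4; 4];
      [:: 0; 0; 0; 0; 0; 0; 3; 3; 3; 3; 3; 3];
      [:: 0; 1; 2; 0; 1; 2; 0; 1; 2; 0; 1; 2];
      [:: 0; 1; 2; 0; 1; 2; 0; 1; 2; 0; 1; 2];
      [:: 0; 1; 2; 0; 1; 2; 0; 1; 2; 0; 1; 2];
      [:: 0; 0; 0; 0; 0; 0; 0; 0; 0; 0; 0; 0];
      [:: 0; 0; 0; 0; 0; 0; 0; 0; 0; 0; 0; 0];
      [:: 0; 0; 0; 0; 0; 0; 3; 3; 3; 3; 3; 3]]%N.

Definition phase (i j : nat) : nat := nth 0%N (nth [::] phase_table i) j.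

Lemma S12_phasesE (R : realType) (a b c d e : R) (i j : 'I_12) :
  S12_phases a b c d e i j = nth 0 [:: 0; a; b; c; d; e] (phase i j).
Proof.
pose val := nth 0 [:: 0; a; b; c; d; e].
rewrite /S12_phases mxE -/(val _) /phase.
(* Both tables agree by computation; the default 0 is [val 0]. *)
change (nth 0 (nth [::] (map (map val) phase_table) i) j = val (phase i j)).
exact: (nth_nth_map _ _ val 0%N).
Qed.

Lemma S12_familyE (R : realType) (a b c d e : R) (i j : 'I_12) :
  S12_family a b c d e i j =
  omega R ^+ exponent i j * expi (nth 0 [:: 0; a; b; c; d; e] (phase i j)).
Proof. by rewrite mxE S12E S12_phasesE. Qed.

Lemma S12_family_dephased (R : realType) (a b c d e : R) (i : 'I_12) :
  S12_family a b c d e 0 i = 1 /\ S12_family a b c d e i 0 = 1.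
Proof.
have : all (fun i => [&& exponent 0 i == 0, exponent i 0 == 0,
    phase 0 i == 0 & phase i 0 == 0])%N (iota 0 12) by vm_compute.
move=> /all_iota_ord/(_ i)/and4P[/eqP e0i /eqP ei0 /eqP p0i /eqP pi0].
by rewrite !S12_familyE e0i ei0 p0i pi0 /= expi0 mulr1.
Qed.

(** * Orthogonality of the rows *)

(* Adding 36 keeps the truncated subtraction honest: it represents [- exponent i' j]. *)
Definition term_exponent (i i' j : nat) : nat :=
  (exponent i j + (36 - exponent i' j))%N.

(* Terms with the same key have the same parameter factor and the same power of
   omega modulo 6, so they differ by a sixth root of unity. *)
Definition term_key (i i' j : nat) : nat * nat * nat :=
  ((if phase i j == phase i' j then (0, 0) else (phase i j, phase i' j)),
   (term_exponent i i' j %% 6))%N.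

Definition fibre_coords (i i' j0 : nat) : int * int :=
  foldr (fun j s => if term_key i i' j == term_key i i' j0 then
    sixth_root_coords (term_exponent i i' j %/ 6) + s else s) 0 (iota 0 12).

Lemma fibre_coordsE (i i' j0 : nat) :
  \sum_(j < 12 | term_key i i' j == term_key i i' j0)
    sixth_root_coords (term_exponent i i' j %/ 6) = fibre_coords i i' j0.
Proof.
exact: (sum_ord_foldr _ 12 (fun j => term_key i i' j == term_key i i' j0)
  (fun j => sixth_root_coords (term_exponent i i' j %/ 6))).
Qed.

(** The parameters enter only through the keys, so this is a finite check on integers. *)
Lemma fibre_coords_eq0 (i i' j0 : 'I_12) :
  i != i' -> fibre_coords i i' j0 = 0.
Proof.
move=> ii'.
have check : all (fun i => all (fun i' => (i == i') ||
    all (fun j0 => fibre_coords i i' j0 == 0) (iota 0 12)) (iota 0 12)) (iota 0 12).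
  by vm_compute.
have /orP[/eqP/val_inj/eqP|check'] := all_iota_ord _ _ (all_iota_ord _ _ check i) i'.
  by rewrite (negPf ii').
exact (eqP (all_iota_ord _ _ check' j0)).
Qed.

Theorem S12_family_hadamard (R : realType) (a b c d e : R) :
  hadamard (S12_family a b c d e).
Proof.
split=> [i j|i i' ii'].
  by rewrite S12_familyE normrM normrX !norm_expi expr1n mulr1.
apply: (@sum_fibres_eq0 _ _ _ (fun j : 'I_12 => term_key i i' j)) => j0.
pose ph m := nth 0 [:: 0; a; b; c; d; e] m.
pose factor (k : nat * nat * nat) : R[i] :=
  expi (ph k.1.1 - ph k.1.2) * omega R ^+ k.2.
pose coords j := sixth_root_coords (term_exponent i i' j %/ 6).
transitivity (\sum_(j < 12 | term_key i i' j == term_key i i' j0)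
    factor (term_key i i' j0) *
    ((coords j).1%:~R + (coords j).2%:~R * omega R ^+ 6)).
  apply: eq_bigr => j /eqP <-; rewrite !S12_familyE rmorphM /=.
  have E'36 : (exponent i' j <= 36)%N by rewrite ltnW ?exponent_lt36.
  rewrite conj_omegaX // conj_expi mulrACA -exprD -expiD.
  rewrite mulrC /factor -mulrA; congr (expi _ * _); last exact: omega_coords.
  (* Where the two phases agree, the key stores [(0, 0)]; both differences are then 0. *)
  by rewrite /ph /term_key; case: eqP => [->|//]; rewrite !subrr.
rewrite -mulr_sumr big_split /coords /= -mulr_suml -!rmorph_sum /=.
by rewrite fibre_coordsE fibre_coords_eq0 // mul0r addr0 mulr0.
Qed.

(** * Rectangles of zero exponents *)

Fixpoint bitseqs (n : nat) : seq bitseq :=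
  if n is m.+1 then [seq b :: s | b <- [:: true; false], s <- bitseqs m] else [:: [::]].

Lemma mem_bitseqs (s : bitseq) : s \in bitseqs (size s).
Proof.
by elim: s => //= b s IHs; rewrite mem_cat cats0; case: b; rewrite map_f ?orbT.
Qed.

(* [m] is the indicator sequence of [Y]. *)
Lemma rectangle_mask (n : nat) (Z : rel nat) (X Y : {set 'I_n}) :
  (forall x y, x \in X -> y \in Y -> Z x y) ->
  exists m : bitseq, [/\ m \in bitseqs n, count id m = #|Y| &
    #|X| <= count (fun x => all (fun y => nth false m y ==> Z x y) (iota 0 n))
              (iota 0 n)]%N.
Proof.
move=> XYZ; pose m := [seq y \in Y | y <- enum 'I_n].
exists m; split.
- by have := mem_bitseqs m; rewrite size_map size_enum_ord.
- by rewrite count_map cardE enumT /= size_filter.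
(* Every row of [X] is among the rows counted on the right. *)
rewrite cardE -(size_map val) -size_filter.
apply: uniq_leq_size; first by rewrite map_inj_uniq ?enum_uniq //; apply: val_inj.
move=> _ /mapP[x + ->]; rewrite mem_enum => xX.
rewrite mem_filter mem_iota ltn_ord /= andbT; apply/allP => y.
rewrite mem_iota => /= y_lt_n; apply/implyP.
rewrite (nth_map (Ordinal y_lt_n)) ?size_enum_ord //.
rewrite (_ : nth _ _ y = Ordinal y_lt_n); last by apply/val_inj/nth_enum_ord.
exact: XYZ.
Qed.

(** Once the columns are chosen, the most rows possible are those vanishing in all of them, so it
    suffices to run through the [2 ^ 12] column sets. *)
Lemma zero_rectangle_exponents (X Y : {set 'I_12}) :
  (1 < #|X|)%N -> (1 < #|Y|)%N ->
  (forall x y, x \in X -> y \in Y -> exponent x y == 0%N) ->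
  (#|X| * #|Y| < 12)%N.
Proof.
move=> X1 Y1 /(rectangle_mask _ (fun x y => exponent x y == 0%N))[m [m12 Ym Xm]].
have /allP/(_ m m12) : all (fun m =>
    let r := count (fun x => all (fun y => nth false m y ==> (exponent x y == 0%N))
               (iota 0 12)) (iota 0 12) in
    let c := count id m in
    [|| r <= 1, c <= 1 | r * c < 12])%N (bitseqs 12) by vm_compute.
move: Xm; set r := count _ _; rewrite -Ym in Y1 * => Xr.
move=> /or3P[|c1|]; first by rewrite leqNgt (leq_trans X1 Xr).
  by rewrite ltnNge c1 in Y1.
by apply: leq_ltn_trans; rewrite leq_mul2r Xr orbT.
Qed.

Theorem mainTheorem4 (R : realType) :
  (forall a b c d e : R, hadamard (S12_family a b c d e)) /\
  (exists U : set 'M[R[i]^o]_12,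
     nbhs (S12 R : 'M[R[i]^o]_12) U /\
     forall a b c d e : R,
       U (S12_family a b c d e) -> ~ dita_type (S12_family a b c d e)).
Proof.
split; first exact: S12_family_hadamard.
(* [P i j] is vacuous at a zero exponent and is an open condition satisfied by [S12] elsewhere. *)
pose P (i j : 'I_12) : set R[i]^o := [set z | exponent i j != 0%N -> z != 1]%classic.
exists [set K | forall i j, P i j (K i j)]%classic; split.
  apply: near_mx_entrywise => i j.
  have [e0|e0] := eqVneq (exponent i j) 0%N.
    by apply: filterE => z; rewrite /P /= e0.
  suff : nbhs (S12 R i j : R[i]^o) [set~ 1]%classic.
    by apply: filterS => z /= /eqP z1 _.
  apply: open_nbhs_nbhs; split => /=; last first.
    by apply/eqP; rewrite S12E omega_neq1 // lt0n e0 exponent_lt36.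
  apply/closed_openC/accessible_closed_set1/hausdorff_accessible.
  exact: norm_hausdorff.
move=> a b c d e Kne /(dita_type_rank_one_submatrix _ _ _ 0 0)[X [Y [X1 Y1 XY12 XYK]]].
suff : (#|X| * #|Y| < 12)%N by rewrite XY12.
apply: zero_rectangle_exponents => // x y xX yY.
apply: contraT => /Kne/eqP[].
have K0 z := S12_family_dephased _ a b c d e z.
(* At the corner the rank-one relation reads [K x y * 1 = 1 * 1]. *)
by have := XYK x y xX yY; rewrite (K0 0).1 (K0 x).2 (K0 y).1 !mulr1.
Qed.
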